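(* Let $n$ and $r$ be integers with $1 \leq r \leq n-2$, and let $G$ be a simple graph on $n$ nodes that is $(r+1)$-vertex connected. Then there exists a configuration $p = (p^1,\ldots,p^n)$ of points in $\mathbb{R}^r$ such that the bar framework $(G,p)$ is $r$-dimensional, is in general position in $\mathbb{R}^r$, and is universally rigid.
   Context: Let $G=(V,E)$ be a simple graph on $n$ nodes, labelled $1,\ldots,n$, with edge set $E(G)$. Vertex connectivity: $G$ is $k$-vertex connected if either $n=k+1$ and $G$ is the complete graph, or $n\ge k+2$ and there does not exist a set of $k-1$ nodes whose deletion disconnects $G$. Bar frameworks: a configuration $p$ in $\mathbb{R}^r$ is a family of points $p^1,\ldots,p^n\in\mathbb{R}^r$, where $p^i$ is assigned to node $i$. The bar framework $(G,p)$ is the graph $G$ together with the configuration $p$; its edges are viewed as the line segments joining $p^i$ and $p^j$ for $\{i,j\}\in E(G)$. The configuration $p$ (or the framework $(G,p)$) is $r$-dimensional if $p^1,\ldots,p^n$ affinely span $\mathbb{R}^r$. It is in general position in $\mathbb{R}^r$ if every $r+1$ of the points $p^1,\ldots,p^n$ are affinely independent. Equivalence and congruence: with $\|\cdot\|$ the Euclidean norm, an $r'$-dimensional framework $(G,p')$ in $\mathbb{R}^{r'}$ is equivalent to an $r$-dimensional framework $(G,p)$ in $\mathbb{R}^r$ if $\|p'^i-p'^j\|^2=\|p^i-p^j\|^2$ for each $\{i,j\}\in E(G)$. They are congruent if $\|p'^i-p'^j\|^2=\|p^i-p^j\|^2$ for all $i,j=1,\ldots,n$ (this forces $r'=r$).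 Universal rigidity: an $r$-dimensional framework $(G,p)$ is universally rigid if there does not exist an $r'$-dimensional framework $(G,p')$ in $\mathbb{R}^{r'}$, for any positive integer $r'\le n-1$, that is equivalent but not congruent to $(G,p)$. *)

(* Defs.v *)
From HB Require Import structures.
From mathcomp Require Import all_boot all_order all_algebra.
From mathcomp Require Import reals.

Set Implicit Arguments.
Unset Strict Implicit.
Unset Printing Implicit Defensive.

Import Order.TTheory GRing.Theory Num.Theory.
Local Open Scope ring_scope.

Record sgraph (n : nat) := SGraph {
  adj :> rel 'I_n;
  adj_sym : symmetric adj;
  adj_irrefl : irreflexive adj }.

Section Connectivity.
Variables (n : nat) (G : sgraph n).

Definition complete_graph : Prop := forall i j : 'I_n, i != j -> G i j.

Definition deletion (S : {set 'I_n}) : rel 'I_n :=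
  [rel i j | [&& G i j, i \notin S & j \notin S]].

Definition disconnected_by (S : {set 'I_n}) : Prop :=
  exists i j : 'I_n,
    [/\ i \notin S, j \notin S & ~~ connect (deletion S) i j].

(* #|S|.+1 = k says that #|S| = k - 1 without truncated subtraction. *)
Definition vertex_connected (k : nat) : Prop :=
  (n = k.+1 /\ complete_graph) \/
  ((k.+2 <= n)%N /\
   ~ exists S : {set 'I_n}, #|S|.+1 = k /\ disconnected_by S).

End Connectivity.

(* The norm that MathComp-Analysis puts on matrices is the sup norm. *)
Definition enorm (R : realType) (r : nat) (u : 'rV[R]_r) : R :=
  Num.sqrt (\sum_(k < r) u 0 k ^+ 2).

Definition configuration (R : realType) (n r : nat) := 'I_n -> 'rV[R]_r.

Section Frameworks.
Variables (R : realType) (n : nat).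

Definition affinely_spanning (r : nat) (p : configuration R n r) : Prop :=
  forall x : 'rV[R]_r, exists c : 'I_n -> R,
    \sum_i c i = 1 /\ \sum_i c i *: p i = x.

Definition affinely_independent_on (r : nat) (p : configuration R n r)
    (S : {set 'I_n}) : Prop :=
  forall c : 'I_n -> R,
    \sum_(i in S) c i = 0 -> \sum_(i in S) c i *: p i = 0 ->
    forall i, i \in S -> c i = 0.

Definition general_position (r : nat) (p : configuration R n r) : Prop :=
  forall S : {set 'I_n}, #|S| = r.+1 -> affinely_independent_on p S.

Definition equivalent (G : sgraph n) (r r' : nat)
    (p : configuration R n r) (p' : configuration R n r') : Prop :=
  forall i j : 'I_n, G i j -> enorm (p' i - p' j) ^+ 2 = enorm (p i - p j) ^+ 2.

Definition congruent (r r' : nat)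
    (p : configuration R n r) (p' : configuration R n r') : Prop :=
  forall i j : 'I_n, enorm (p' i - p' j) ^+ 2 = enorm (p i - p j) ^+ 2.

Definition universally_rigid (G : sgraph n) (r : nat)
    (p : configuration R n r) : Prop :=
  ~ exists (r' : nat) (p' : configuration R n r'),
      [/\ (0 < r' <= n - 1)%N, affinely_spanning p',
          equivalent G p p' & ~ congruent p p'].

End Frameworks.

(* Main.v *)
Require Import Defs.
From mathcomp Require Import all_boot all_order all_algebra.
From mathcomp Require Import reals.
From mathcomp Require Import ring zify.

Set Implicit Arguments.
Unset Strict Implicit.
Unset Printing Implicit Defensive.

Import Order.TTheory GRing.Theory Num.Theory.
Local Open Scope ring_scope.

(** Write d = n - r - 1 >= 1.  The configuration is obtained as a Gale dual of
    an orthogonal representation of G: a matrix F with n rows in R^d whose rows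
    i and j are orthogonal whenever i and j are distinct and non-adjacent.
    Suppose that any d rows of F are linearly independent and that the rows of
    F sum to zero.  Then F F^T is a positive semidefinite stress matrix of G of
    rank n - r - 1, and a basis of the vectors q with q F = 0 and q . 1 = 0
    gives the coordinates of a framework p in R^r that carries this stress.

    Why p works.  An affine dependency among the points of p with support in a
    set S of size r + 1 has the form F z with z in R^d; it vanishes at the d
    nodes outside S, and d rows of F span R^d, so z = 0
    ([general_position_spanning]).  Universal rigidity
    ([stressed_framework_universally_rigid]) is the energy argument of Connelly:
    the energy of p' is a combination of the squared lengths of the edges, so an
    equivalent p' has energy zero, like p, whence P'^T F = 0.  Let D be the
    matrix of changes of squared distances.  Expanding the squares shows that
    all rows of D F are one and the same vector w.  The i-th row of F is
    orthogonal to the i-th row of D F, because D vanishes where F F^T does not;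
    so w is orthogonal to every row of F and w = 0.  Now row i of D is a
    dependency among the rows of F at the non-neighbours of i.  By connectivity
    there are at most d of them, so D = 0.

    Existence of F (a theorem of Lovász, Saks and Schrijver,
    [exists_general_position_rep]).  (r+1)-connectivity says that every set of
    more than d nodes induces a connected subgraph.  The heart of the proof,
    [general_position_denseT], is that a representation F of G[U] whose
    restriction to U - a is in general position is a Zariski limit of
    representations of G[U] in general position.  If U has at most d elements,
    row a can be moved along a vector orthogonal to all other rows.  If U is
    larger, then G[U] is connected, and the set W of those v for which U - v is
    in general position can be enlarged along any edge wb leaving it: by
    induction F can be perturbed on U - b into general position, and row b can
    follow by projection because its non-neighbours in U lie in U - w, so their
    rows are independent.  When W = U we are done, as no set of at most d rows
    is all of U. *)

(** * Gram determinants and orthogonal projection *)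

Section GramDeterminant.
Variables (n d : nat).
Implicit Types (S N : {set 'I_n}) (b : 'I_n).

(** The rows outside S are replaced by zero rows, and a unit diagonal is added
    there in [gram_mx].  The Gram determinant of the rows in S becomes the
    determinant of an n x n matrix, whatever the size of S. *)
Definition mask (A : comNzRingType) S (F : 'M[A]_(n, d)) : 'M[A]_(n, d) :=
  \matrix_(i, j) (if i \in S then F i j else 0).

Definition off_diag (A : comNzRingType) S : 'M[A]_n :=
  diag_mx (\row_i (i \notin S)%:R).

Definition gram_mx (A : comNzRingType) S (F : 'M[A]_(n, d)) : 'M[A]_n :=
  mask S F *m (mask S F)^T + off_diag A S.

Definition gram_det (A : comNzRingType) S (F : 'M[A]_(n, d)) : A :=
  \det (gram_mx S F).

(** Up to the factor [gram_det S F], the component of v orthogonal to the rows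
    of F in S.  Multiplying by the determinant instead of dividing keeps it
    polynomial in F and meaningful over any commutative ring. *)
Definition normal_part (A : comNzRingType) S (v : 'rV[A]_d)
    (F : 'M[A]_(n, d)) : 'rV[A]_d :=
  v *m ((gram_det S F)%:M - (mask S F)^T *m \adj (gram_mx S F) *m mask S F).

Definition move (A : comNzRingType) b (y : 'rV[A]_d) (F : 'M[A]_(n, d)) :
    'M[A]_(n, d) :=
  \matrix_(i, j) (if i == b then y 0 j else F i j).

Section Ring.
Variable A : comNzRingType.
Implicit Types (F : 'M[A]_(n, d)) (v y : 'rV[A]_d).

Lemma trmx_mask_off_diag S F : (mask S F)^T *m off_diag A S = 0.
Proof.
apply/matrixP=> i j; rewrite mul_mx_diag !mxE.
by case: (j \in S); rewrite ?mulr0 ?mul0r.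
Qed.

(** With B the masked matrix, M its Gram matrix and E the added diagonal,
    B B^T = M - E and E is fixed by M; hence adj M (M - E) = det M (1 - E), and
    E is killed by B^T. *)
Lemma normal_part_mask S v F : normal_part S v F *m (mask S F)^T = 0.
Proof.
set B := mask S F; set M := gram_mx S F.
have ME : M *m off_diag A S = off_diag A S.
  rewrite /M /gram_mx mulmxDl -mulmxA trmx_mask_off_diag mulmx0 add0r.
  apply/matrixP=> i j; rewrite mul_mx_diag !mxE.
  case: (i =P j) => [->|_]; rewrite ?mulr0n ?mul0r // mulr1n.
  by case: (j \in S); rewrite ?mulr0 ?mulr1.
have adjE : \adj M *m off_diag A S = gram_det S F *: off_diag A S.
  by rewrite -{1}ME mulmxA mul_adj_mx mul_scalar_mx.
have BBt : B *m B^T = M - off_diag A S by rewrite /M /gram_mx addrK.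
have adjBBt :
    \adj M *m (M - off_diag A S) = gram_det S F *: (1%:M - off_diag A S).
  by rewrite mulmxBr mul_adj_mx adjE scalerBr scalemx1.
rewrite /normal_part -mulmxA mulmxBl -[_ *m B *m _]mulmxA BBt.
rewrite -[_ *m _ *m (M - _)]mulmxA adjBBt.
rewrite -scalemxAr [_ *m (1%:M - _)]mulmxBr mulmx1 trmx_mask_off_diag subr0.
by rewrite mul_scalar_mx subrr mulmx0.
Qed.

Lemma normal_part_orth S v F i : i \in S ->
  normal_part S v F *m (row i F)^T = 0.
Proof.
move=> iS; move: (normal_part_mask S v F).
move: (normal_part S v F) => y /matrixP H.
apply/matrixP=> k l; have := H k i; rewrite !mxE; apply: etrans.
by apply: eq_bigr => m _; rewrite !mxE iS.
Qed.

Lemma normal_part_id S v F : (forall i, i \in S -> v *m (row i F)^T = 0) ->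
  normal_part S v F = gram_det S F *: v.
Proof.
move=> vF; have vB : v *m (mask S F)^T = 0.
  apply/matrixP=> k i; rewrite !mxE; case iS: (i \in S).
    have /matrixP/(_ 0 0) := vF i iS; rewrite !mxE; apply: etrans.
    by apply: eq_bigr => m _; rewrite !mxE iS ord1.
  by apply: big1 => m _; rewrite !mxE iS mulr0.
by rewrite /normal_part mulmxBr !mulmxA vB !mul0mx subr0 mul_mx_scalar.
Qed.

Lemma mask_move S b y F : b \notin S -> mask S (move b y F) = mask S F.
Proof.
move=> bS; apply/matrixP=> i j; rewrite !mxE; case: ifP => // iS.
by case: eqP => // e; rewrite -e iS in bS.
Qed.

Lemma gram_det_move S b y F :
  b \notin S -> gram_det S (move b y F) = gram_det S F.
Proof. by move=> bS; rewrite /gram_det /gram_mx mask_move. Qed.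

Lemma move_row b F : move b (row b F) F = F.
Proof. by apply/matrixP=> i j; rewrite !mxE; case: eqP => // ->. Qed.

Lemma row_move b y F i : row i (move b y F) = if i == b then y else row i F.
Proof. by apply/rowP=> j; rewrite !mxE; case: eqP => //; rewrite mxE. Qed.

End Ring.

Section Morphism.
Variables (A B : comNzRingType) (phi : {rmorphism A -> B}).

Lemma map_mask S (F : 'M[A]_(n, d)) :
  map_mx phi (mask S F) = mask S (map_mx phi F).
Proof. by apply/matrixP=> i j; rewrite !mxE; case: ifP; rewrite ?rmorph0. Qed.

Lemma map_gram_mx S (F : 'M[A]_(n, d)) :
  map_mx phi (gram_mx S F) = gram_mx S (map_mx phi F).
Proof.
rewrite map_mxD map_mxM -map_trmx map_mask; congr (_ + _).
rewrite /off_diag map_diag_mx; congr diag_mx.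
by apply/rowP=> i; rewrite !mxE rmorph_nat.
Qed.

Lemma map_gram_det S (F : 'M[A]_(n, d)) :
  phi (gram_det S F) = gram_det S (map_mx phi F).
Proof. by rewrite -det_map_mx map_gram_mx. Qed.

Lemma map_normal_part S v (F : 'M[A]_(n, d)) :
  map_mx phi (normal_part S v F) = normal_part S (map_mx phi v) (map_mx phi F).
Proof.
rewrite map_mxM map_mxB map_scalar_mx !map_mxM -map_trmx map_mx_adj.
by rewrite map_gram_mx map_mask /= map_gram_det.
Qed.

Lemma map_move b y (F : 'M[A]_(n, d)) :
  map_mx phi (move b y F) = move b (map_mx phi y) (map_mx phi F).
Proof. by apply/matrixP=> i j; rewrite !mxE; case: ifP. Qed.

End Morphism.
End GramDeterminant.

Section Independence.
Variables (R : realFieldType) (n d : nat).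
Implicit Types (S T U W : {set 'I_n}) (F : 'M[R]_(n, d)).

Lemma gram_eq0 m k (B : 'M[R]_(m, k)) : \tr (B *m B^T) = 0 -> B = 0.
Proof.
rewrite /mxtrace => H; apply/matrixP=> i j; rewrite mxE.
have sq k' : (B *m B^T) k' k' = \sum_l B k' l ^+ 2.
  by rewrite mxE; apply: eq_bigr => l _; rewrite mxE expr2.
have ge0 k' : 0 <= (B *m B^T) k' k'.
  by rewrite sq sumr_ge0 // => l _; rewrite sqr_ge0.
have /eqP := H; rewrite psumr_eq0 // => /allP/(_ i (mem_index_enum _)) /=.
rewrite sq psumr_eq0 => [/allP/(_ j (mem_index_enum _)) /=|l _];
  last exact: sqr_ge0.
by rewrite sqrf_eq0 => /eqP.
Qed.

Lemma mul_mask S F (c : 'rV[R]_n) : (forall i, i \notin S -> c 0 i = 0) ->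
  c *m mask S F = c *m F.
Proof.
move=> cS; apply/rowP=> j; rewrite !mxE; apply: eq_bigr => i _; rewrite !mxE.
by case: (boolP (i \in S)) => // /cS ->; rewrite !mul0r.
Qed.

(** A vector in the kernel of the Gram matrix is supported on S, since the added
    diagonal reproduces its entries outside S; positivity of the scalar product
    then makes it a dependency among the rows. *)
Lemma gram_detP S F :
  reflect (forall c : 'rV[R]_n,
             (forall i, i \notin S -> c 0 i = 0) -> c *m F = 0 -> c = 0)
          (gram_det S F != 0).
Proof.
apply: (iffP idP) => [uM c cS cF|indep].
  have cM : c *m gram_mx S F = 0.
    rewrite mulmxDr mulmxA mul_mask // cF mul0mx add0r.
    apply/rowP=> i; rewrite mul_mx_diag !mxE.
    by case: (boolP (i \in S)) => [|/cS ->]; rewrite ?mulr0 ?mul0r.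
  have u : gram_mx S F \in unitmx by rewrite unitmxE unitfE.
  by rewrite -(mulmxK u c) cM mul0mx.
apply/negP=> /eqP/eqP/det0P[c /eqP c0 cM]; apply: c0.
have cE : c *m off_diag R S = 0.
  have := congr1 (fun x => x *m off_diag R S) cM.
  rewrite mulmxDr mulmxDl mul0mx -!mulmxA trmx_mask_off_diag !mulmx0 add0r => H.
  apply/rowP=> i; have := congr1 (fun x : 'rV_n => x 0 i) H.
  rewrite mulmxA !mul_mx_diag !mxE => <-.
  by case: (i \in S); rewrite ?mulr0 // !mulr1.
have cS i : i \notin S -> c 0 i = 0.
  move=> iS; have := congr1 (fun x : 'rV_n => x 0 i) cE.
  by rewrite mul_mx_diag !mxE iS mulr1.
apply: indep => //; apply: gram_eq0.
rewrite -(mul_mask F cS) trmx_mul mulmxA -[c *m _ *m _]mulmxA.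
move: cM; rewrite mulmxDr cE addr0 => ->.
by rewrite mul0mx mxtrace0.
Qed.

Lemma gram_det_sub S T F :
  S \subset T -> gram_det T F != 0 -> gram_det S F != 0.
Proof.
move=> /subsetP ST /gram_detP H; apply/gram_detP=> c cS; apply: H => i iT.
by apply: cS; apply: contra iT; apply: ST.
Qed.

Lemma exists_normal S F : (#|S| < d)%N ->
  exists2 x : 'rV[R]_d, x != 0 & forall i, i \in S -> x *m (row i F)^T = 0.
Proof.
move=> Sd; pose B := rowsub (fun k : 'I_#|S| => enum_val k) F.
have : (kermx B^T) != 0.
  rewrite -mxrank_eq0 mxrank_ker mxrank_tr -lt0n subn_gt0.
  exact: leq_ltn_trans (rank_leq_row _) Sd.
move=> K0; exists (nz_row (kermx B^T)); first by rewrite nz_row_eq0.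
move=> i iS; have : nz_row (kermx B^T) *m B^T = 0.
  by apply/sub_kermxP; exact: nz_row_sub.
move=> /rowP/(_ (enum_rank_in iS i)) H; apply/rowP=> k; rewrite ord1.
rewrite mxE in H; rewrite !mxE in H *; rewrite -[RHS]H.
by apply: eq_bigr => l _; rewrite !mxE enum_rankK_in.
Qed.
End Independence.

(** * Orthogonal representations in general position *)

Section Density.
Variables (R : realFieldType) (n d : nat) (G : sgraph n).
Implicit Types (S U W N : {set 'I_n}) (F : 'M[R]_(n, d)).
Implicit Types (Q : 'M[R]_(n, d) -> R).

Definition non_neighbours (b : 'I_n) : {set 'I_n} :=
  [set i | (i != b) && ~~ G b i].

Definition orthogonal_rep U F : Prop :=
  forall i j, i \in U -> j \in U -> i != j -> ~~ G i j ->
    row i F *m (row j F)^T = 0.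

Definition rows_in_general_position U F : Prop :=
  forall S, S \subset U -> (#|S| <= d)%N -> gram_det S F != 0.

(** Polynomiality is tested on polynomial curves.  This class is stable under
    products and under substitution of maps that make sense over any commutative
    ring, such as [normal_part], and it needs no multivariate polynomials. *)
Definition polynomial_function Q : Prop :=
  forall C : 'M[{poly R}]_(n, d), exists q : {poly R},
    forall t, Q (map_mx (horner_eval t) C) = q.[t].

(** The requirement that any nonvanishing polynomial can be preserved says that
    F is in the Zariski closure of the representations in general position. *)
Definition general_position_dense U : Prop :=
  forall a F Q, a \in U -> orthogonal_rep U F ->
    rows_in_general_position (U :\ a) F -> polynomial_function Q -> Q F != 0 ->
  exists F',
    [/\ orthogonal_rep U F', rows_in_general_position U F' & Q F' != 0].

Lemma exists_nonroot (q : {poly R}) : q != 0 -> exists t, q.[t] != 0.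
Proof.
move=> q0; pose s := [seq (k%:R : R) | k <- iota 0 (size q)].
have : ~~ all (root q) s.
  apply/negP=> rs; have us : uniq s.
    by rewrite map_inj_uniq ?iota_uniq // => i j /eqP; rewrite eqr_nat => /eqP.
  by have := max_poly_roots q0 rs us; rewrite size_map size_iota ltnn.
by case/allPn=> t _; exists t.
Qed.

Lemma map_horner_polyC m k t (B : 'M[R]_(m, k)) :
  map_mx (horner_eval t) (map_mx polyC B) = B.
Proof. by apply/matrixP=> i j; rewrite !mxE /horner_eval hornerC. Qed.

Lemma orthogonal_rep_sub S U F :
  S \subset U -> orthogonal_rep U F -> orthogonal_rep S F.
Proof. by move=> /subsetP SU rF i j /SU iU /SU jU; apply: rF. Qed.

Lemma orthogonal_rep_move U b y F : orthogonal_rep (U :\ b) F ->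
  (forall i, i \in non_neighbours b :&: U -> y *m (row i F)^T = 0) ->
  orthogonal_rep U (move b y F).
Proof.
move=> rF yF i j iU jU ij Gij; rewrite !row_move.
case: (i =P b) => [ib|/eqP ib]; case: (j =P b) => [jb|/eqP jb].
- by rewrite ib jb eqxx in ij.
- by apply: yF; rewrite !inE jb jU -ib Gij.
- apply: trmx_inj; rewrite trmx_mul trmxK trmx0; apply: yF.
  by rewrite !inE ib iU adj_sym -jb Gij.
- by apply: rF => //; rewrite !inE ?ib ?jb.
Qed.

(** When U has at most d elements, fewer than d rows remain besides row a, so
    some x is orthogonal to all of them; replacing row a by itself plus t x
    keeps the orthogonality and gives independent rows as soon as the new row is
    not orthogonal to x, which holds for all but finitely many t. *)
Lemma general_position_dense_small U :
  (#|U| <= d)%N -> general_position_dense U.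
Proof.
move=> Ud a F Q aU rF gpF polyQ QF.
have Uad : (#|U :\ a| < d)%N by rewrite (leq_trans _ Ud) // (cardsD1 a U) aU.
have [x x0 xF] := exists_normal F Uad.
pose C : 'M[{poly R}]_(n, d) :=
  move a (map_mx polyC (row a F) + 'X *: map_mx polyC x) (map_mx polyC F).
have CE t : map_mx (horner_eval t) C = move a (row a F + t *: x) F.
  rewrite map_move map_horner_polyC; congr move.
  by apply/rowP=> j; rewrite !mxE /= /horner_eval !hornerE.
have [q qE] := polyQ C.
pose s := (row a F *m x^T) 0 0; pose e := (x *m x^T) 0 0.
have e0 : e != 0.
  apply: contraNneq x0 => H; apply/eqP/gram_eq0.
  by rewrite (mx11_scalar (x *m x^T)) -/e H mxtrace_scalar mul0rn.
have q0 : q != 0.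
  apply: contraNneq QF => H; have := qE 0.
  by rewrite CE scale0r addr0 move_row H horner0 => ->.
have l0 : s%:P + e *: 'X != 0.
  apply: contraNneq e0 => /(congr1 (fun p : {poly R} => p`_1)).
  by rewrite coefD coefC coefZ coefX coef0 add0r mulr1 => ->.
(* The second factor is the scalar product of the moved row with x. *)
have [t] := exists_nonroot (mulf_neq0 q0 l0).
rewrite hornerM mulf_eq0 negb_or -qE CE => /andP[Qt lt].
exists (move a (row a F + t *: x) F); split=> //.
  apply: orthogonal_rep_move => [|i].
    by apply: orthogonal_rep_sub rF; apply: subsetDl.
  rewrite !inE => /andP[/andP[ia Gai] iU].
  rewrite mulmxDl -scalemxAl xF ?inE ?ia // scaler0 addr0.
  by apply: rF; rewrite // eq_sym.
move=> S SU _; apply: gram_det_sub SU _; apply/gram_detP => c cU cF.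
have ca : c 0 a = 0.
  have : (c *m (move a (row a F + t *: x) F *m x^T)) 0 0 = 0.
    by rewrite mulmxA cF mul0mx mxE.
  rewrite mxE (bigD1 a) //= big1 ?addr0 => [|i ia].
    rewrite mxE [X in X = _ -> _](_ : _ = c 0 a * (s + t * e)); last first.
      congr (_ * _); rewrite /s /e !mxE mulr_sumr -big_split.
      apply: eq_bigr => k _ /=.
      by rewrite !mxE eqxx; ring.
    move=> /eqP; rewrite mulf_eq0 => /orP[/eqP //|] /eqP H.
    by move: lt; rewrite !hornerE mulrC H eqxx.
  case: (boolP (i \in U)) => [iU|/cU ->]; last by rewrite mul0r.
  have := xF i; rewrite !inE ia iU => /(_ isT)/(congr1 trmx).
  rewrite trmx_mul trmxK trmx0 => /(congr1 (fun z : 'M_1 => z 0 0)) H.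
  rewrite [X in _ * X](_ : _ = 0) ?mulr0 //; move: H; rewrite !mxE => H.
  by rewrite -[RHS]H; apply: eq_bigr => k _; rewrite !mxE (negPf ia).
have /gram_detP indep := gpF _ (subxx _) (ltnW Uad).
have cUa i : i \notin U :\ a -> c 0 i = 0.
  by rewrite !inE negb_and negbK => /orP[/eqP -> //|/cU].
apply: indep => //; have aUa : a \notin U :\ a by rewrite !inE eqxx.
by rewrite -(mul_mask F cUa) -(mask_move (row a F + t *: x) F aUa) mul_mask.
Qed.

(** The induced representation on U - v is in general position for every v in
    W: a set S avoids some v of W exactly when W is not a subset of S. *)
Definition general_position_avoiding U W F : Prop :=
  forall S, S \subset U -> (#|S| <= d)%N -> ~~ (W \subset S) ->
    gram_det S F != 0.

(** The edge wb puts the non-neighbours of b in U into U - w, where the rows of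
    F are independent.  So [ext], which re-projects row b after a change of the
    other rows, fixes F, and any polynomial condition satisfied by F, including
    the general position already achieved for W, can be pulled back along [ext]
    to a polynomial condition on U - b. *)
Lemma enlarge_along_edge U W b w F Q :
  (#|non_neighbours b| <= d)%N -> general_position_dense (U :\ b) ->
  W \subset U -> w \in W -> b \in U :\: W -> G w b ->
  orthogonal_rep U F -> general_position_avoiding U W F ->
  polynomial_function Q -> Q F != 0 ->
  exists F', [/\ orthogonal_rep U F',
    general_position_avoiding U (b |: W) F' & Q F' != 0].
Proof.
move=> Nd dense WU wW; rewrite inE => /andP[bW bU] Gwb rF gF polyQ QF.
pose N := non_neighbours b :&: U.
have wN : w \notin N by rewrite !inE adj_sym Gwb andbF.
have Nle : (#|N| <= d)%N.
  by apply: leq_trans Nd; apply: subset_leq_card (subsetIl _ _).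
have N0 : gram_det N F != 0.
  by apply: gF; rewrite ?subsetIr //; apply: contra wN => /subsetP; apply.
have bN : b \notin N by rewrite !inE eqxx.
(* Dividing by the constant determinant at F makes [ext] fix F. *)
pose v := (gram_det N F)^-1 *: row b F.
pose ext g := move b (normal_part N v g) g.
have extF : ext F = F.
  rewrite /ext normal_part_id ?scalerA ?mulfV ?scale1r ?move_row // => i.
  rewrite !inE => /andP[/andP[ib Gbi] iU].
  by rewrite /v -scalemxAl rF ?scaler0 // eq_sym.
pose P S := [&& S \subset U, (#|S| <= d)%N & ~~ (W \subset S)].
pose Q' g := Q (ext g) * \prod_(S | P S) gram_det S (ext g).
have polyQ' : polynomial_function Q'.
  move=> C; pose E := move b (normal_part N (map_mx polyC v) C) C.
  have EE t : map_mx (horner_eval t) E = ext (map_mx (horner_eval t) C).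
    by rewrite map_move map_normal_part map_horner_polyC.
  have [q qE] := polyQ E; exists (q * \prod_(S | P S) gram_det S E) => t.
  rewrite hornerM -qE EE /Q'; congr (_ * _).
  rewrite -[RHS]/(horner_eval t _) rmorph_prod; apply: eq_bigr => S _.
  by rewrite map_gram_det EE.
have Q'F : Q' F != 0.
  by rewrite mulf_neq0 ?extF //; apply/prodf_neq0 => S /and3P[]; apply: gF.
have wU := subsetP WU _ wW.
have wb : w != b by apply: contraNneq bW => <-.
have [|||g [rg gpg]] := dense w F Q' _ _ _ polyQ' Q'F.
- by rewrite !inE wb.
- by apply: orthogonal_rep_sub rF; apply: subsetDl.
- move=> S SU Sd; apply: gF => //.
    by rewrite !(subset_trans SU, subset_trans (subsetDl _ _)) ?subsetDl.
  by apply/negP=> /subsetP/(_ _ wW)/(subsetP SU); rewrite !inE eqxx.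
rewrite /Q' mulf_eq0 negb_or => /andP[Qg /prodf_neq0 gg].
exists (ext g); split=> //.
  by apply: orthogonal_rep_move => // i iN; apply: normal_part_orth.
move=> S SU Sd; rewrite subUset sub1set negb_and.
case: (boolP (b \in S)) => /= [bS WS|bS _].
  by apply: gg; rewrite /P SU Sd.
rewrite gram_det_move //; apply: gpg => //.
by rewrite subsetD1 SU.
Qed.

(** Connectivity of the induced subgraphs on more than d nodes, in terms of
    cuts. *)
Definition large_sets_connected : Prop :=
  forall U W, (d < #|U|)%N -> W \subset U -> W != set0 -> W != U ->
  exists w b, [/\ w \in W, b \in U :\: W & G w b].

Lemma general_position_denseT :
  large_sets_connected -> (forall b, (#|non_neighbours b| <= d)%N) ->
  forall U, general_position_dense U.
Proof.
move=> connG Nd U.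
have [m] := ubnP #|U|; elim: m U => // m IHm U; rewrite ltnS => Um.
case: (leqP #|U| d) => [|dU]; first exact: general_position_dense_small.
move=> a F Q aU rF gpF polyQ QF.
have grow k W F1 : (#|U :\: W| <= k)%N -> W \subset U -> W != set0 ->
    orthogonal_rep U F1 -> general_position_avoiding U W F1 -> Q F1 != 0 ->
    exists F',
      [/\ orthogonal_rep U F', rows_in_general_position U F' & Q F' != 0].
  have full F2 : orthogonal_rep U F2 -> general_position_avoiding U U F2 ->
      Q F2 != 0 ->
      exists F',
        [/\ orthogonal_rep U F', rows_in_general_position U F' & Q F' != 0].
    move=> rF2 gF2 QF2; exists F2; split=> // S SU Sd; apply: gF2 => //.
    by apply: contraL dU => /subset_leq_card US; rewrite -leqNgt (leq_trans US).
  elim: k W F1 => [|k IHk] W F1 Wk WU W0 rF1 gF1 QF1;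
    have [WeU|WnU] := eqVneq W U.
  - by apply: (full F1) => //; rewrite -{2}WeU.
  - by move: Wk; rewrite leqn0 cards_eq0 setD_eq0 => UW;
      rewrite eqEsubset WU UW in WnU.
  - by apply: (full F1) => //; rewrite -{2}WeU.
  have [w [b [wW bUW Gwb]]] := connG _ _ dU WU W0 WnU.
  have bU : b \in U by move: bUW; rewrite inE => /andP[].
  have dense : general_position_dense (U :\ b).
    by apply: IHm; rewrite (cardsD1 b U) bU in Um.
  have [F2 [rF2 gF2 QF2]] :=
    enlarge_along_edge (Nd b) dense WU wW bUW Gwb rF1 gF1 polyQ QF1.
  apply: (IHk (b |: W) F2) => //.
  - rewrite -ltnS (leq_trans _ Wk) // setUC -setDDl.
    by rewrite [X in (_ < X)%N](cardsD1 b) bUW.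
  - by rewrite subUset sub1set bU.
  - by apply/set0Pn; exists b; rewrite !inE eqxx.
apply: (grow #|U :\: [set a]| [set a] F) => //.
- by rewrite sub1set.
- by apply/set0Pn; exists a; rewrite !inE.
- move=> S SU Sd; rewrite sub1set => aS; apply: gpF => //.
  by rewrite subsetD1 SU.
Qed.

(** Nodes are added one at a time, with the zero row, followed by a perturbation
    into general position. *)
Theorem exists_general_position_rep :
  large_sets_connected -> (forall b, (#|non_neighbours b| <= d)%N) ->
  exists F : 'M[R]_(n, d),
    orthogonal_rep setT F /\ rows_in_general_position setT F.
Proof.
move=> connG Nd.
suff H k U : #|U| = k -> exists F : 'M[R]_(n, d),
    orthogonal_rep U F /\ rows_in_general_position U F.
  exact: (H _ setT erefl).
elim: k U => [|k IHk] U Uk.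
  have -> : U = set0 by apply/eqP; rewrite -cards_eq0 Uk.
  exists 0; split=> [i j|S]; first by rewrite inE.
  rewrite subset0 => /eqP -> _; apply/gram_detP => c c0 _.
  by apply/rowP=> i; rewrite c0 ?inE // mxE.
have /card_gt0P[a aU] : (0 < #|U|)%N by rewrite Uk.
have [|F [rF gpF]] := IHk (U :\ a).
  by rewrite (cardsD1 a) aU in Uk; case: Uk.
have aUa : a \notin U :\ a by rewrite !inE eqxx.
have [||||F' [rF' gpF' _]] :=
  general_position_denseT connG Nd (a := a) (F := move a 0 F) (Q := fun=> 1) aU;
  rewrite ?oner_neq0 //.
- by apply: orthogonal_rep_move => // i _; rewrite mul0mx.
- move=> S SU Sd; rewrite gram_det_move; first exact: gpF.
  by apply: contra aUa; apply: (subsetP SU).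
- by move=> C; exists 1 => t; rewrite hornerC.
by exists F'.
Qed.
End Density.

(** * Vertex connectivity *)

Lemma exists_intermediate_set (T : finType) (A B : {set T}) k :
  A \subset B -> (#|A| <= k)%N -> (k <= #|B|)%N ->
  exists X : {set T}, [/\ A \subset X, X \subset B & #|X| = k].
Proof.
move=> AB + kB; elim: k kB => [|k IH] kB Ak.
  by exists A; split=> //; apply/eqP; rewrite -leqn0.
have [Ak1|Ak1] := eqVneq #|A| k.+1; first by exists A.
have [||X [AX XB Xk]] := IH; first exact: ltnW.
  by rewrite -ltnS ltn_neqAle Ak1.
have /subsetPn[x xB xX] : ~~ (B \subset X).
  by apply: contraL kB => /subset_leq_card; rewrite Xk -ltnNge ltnS.
exists (x |: X); split; rewrite ?cardsU1 ?xX ?Xk //.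
  by rewrite subsetU // AX orbT.
by rewrite subUset sub1set xB.
Qed.

Section Connectivity.
Variables (n : nat) (G : sgraph n).

(** Vertex connectivity forbids separators of size exactly r; a smaller one can
    be padded with nodes other than i and j, of which there are enough. *)
Lemma connect_delete_few r (S : {set 'I_n}) (i j : 'I_n) :
  (r.+2 <= n)%N -> vertex_connected G r.+1 -> (#|S| <= r)%N ->
  i \notin S -> j \notin S -> connect (deletion G S) i j.
Proof.
move=> rn conn Sr iS jS; have [->|ij] := eqVneq i j; first exact: connect0.
case: conn => [[_ compl]|[_ conn]].
  by apply: connect1; rewrite /deletion /= iS jS compl.
have SX : S \subset ~: [set i; j].
  by apply/subsetP=> k kS; rewrite !inE; apply: contraL kS => /orP[] /eqP ->.
have [|T [ST /subsetP TX Tr]] := exists_intermediate_set SX Sr.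
  by rewrite cardsCs setCK card_ord cards2 ij leq_subRL ?(leq_trans _ rn).
have [iT jT] : i \notin T /\ j \notin T.
  by split; apply/negP=> /TX; rewrite !inE eqxx ?orbT.
have : connect (deletion G T) i j.
  apply/negPn/negP=> nc; apply: conn; exists T.
  by split; [rewrite Tr | exists i, j].
apply: connect_sub => x y /and3P[Gxy xT yT]; apply: connect1.
rewrite /deletion /= Gxy.
by rewrite (contra (subsetP ST x) xT) (contra (subsetP ST y) yT).
Qed.

Lemma crossing_edge (e : rel 'I_n) (W : {set 'I_n}) x y :
  connect e x y -> x \in W -> y \notin W ->
  exists w b, [/\ w \in W, b \notin W & e w b].
Proof.
move=> /connectP[p + ->]; elim: p x => [|z p IH] x /=; first by move=> _ ->.
move=> /andP[exz ep] xW yW.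
case: (boolP (z \in W)) => zW; first exact: IH ep zW yW.
by exists x, z.
Qed.

Lemma vertex_connected_large_sets r d : n = (d + r.+1)%N -> (0 < d)%N ->
  vertex_connected G r.+1 -> large_sets_connected d G.
Proof.
move=> nE d0 conn U W dU WU /set0Pn[w wW] WnU.
have /set0Pn[b bUW] : U :\: W != set0.
  by apply: contraNneq WnU => /eqP; rewrite setD_eq0 eqEsubset WU => ->.
move: (bUW); rewrite inE => /andP[bW bU].
have wb : connect (deletion G (~: U)) w b.
  apply: connect_delete_few conn _ _ _; last 2 first.
  - by rewrite inE negbK (subsetP WU).
  - by rewrite inE negbK.
  - by lia.
  - by rewrite cardsCs setCK card_ord; lia.
have [x [y [xW yW /and3P[Gxy _ yU]]]] := crossing_edge wb wW bW.
by exists x, y; split=> //; rewrite inE yW; rewrite inE negbK in yU.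
Qed.

(** Otherwise b and its non-neighbours would form a large set in which b is
    isolated. *)
Lemma few_non_neighbours r d b : n = (d + r.+1)%N -> (0 < d)%N ->
  vertex_connected G r.+1 -> (#|non_neighbours G b| <= d)%N.
Proof.
move=> nE d0 conn; rewrite leqNgt; apply/negP=> dN.
have bN : b \notin non_neighbours G b by rewrite !inE eqxx.
have [|||| w [v [wb vN Gwv]]] :=
  vertex_connected_large_sets nE d0 conn (U := b |: non_neighbours G b)
    (W := [set b]).
- by rewrite cardsU1 bN ltnW.
- by rewrite subsetUl.
- by apply/set0Pn; exists b; rewrite inE.
- apply/eqP=> /(congr1 (fun A : {set 'I_n} => #|A|)).
  by rewrite cards1 cardsU1 bN; lia.
move: wb vN; rewrite inE => /eqP wb; rewrite -{}wb !inE in Gwv *.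
by move=> /andP[vw]; rewrite (negPf vw) /= Gwv.
Qed.
End Connectivity.

(** * Gale duality *)

Section Geometry.
Variables (R : realFieldType) (n d : nat).
Implicit Types (F : 'M[R]_(n, d)).

(** The double annihilator of a column space, with the pseudo-inverse of A as an
    explicit preimage. *)
Lemma in_column_space m k (A : 'M[R]_(m, k)) (v : 'cV[R]_m) :
  kermx A *m v = 0 -> exists z : 'cV[R]_k, v = A *m z.
Proof.
move=> kv; exists (pinvmx A *m v); apply/eqP; rewrite -subr_eq0 mulmxA.
have /submxP[D DE] : (1%:M - A *m pinvmx A <= kermx A)%MS.
  by apply/sub_kermxP; rewrite mulmxBl mul1mx mulmxKpV ?subrr.
by rewrite -{1}(mul1mx v) -mulmxBl DE -mulmxA kv mulmx0.
Qed.

Lemma rows_spanning (S : {set 'I_n}) F (z : 'cV[R]_d) :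
  #|S| = d -> gram_det S F != 0 ->
  (forall i, i \in S -> (F *m z) i 0 = 0) -> z = 0.
Proof.
move=> Sd /gram_detP indep Fz.
pose B := rowsub (fun k : 'I_#|S| => enum_val k) F.
have Bz : B *m z = 0.
  apply/colP=> k; have := Fz _ (enum_valP k); rewrite !mxE => H.
  rewrite -[RHS]H.
  by apply: eq_bigr => l _; rewrite !mxE.
have freeB : row_free B.
  rewrite -kermx_eq0; apply/eqP/row_matrixP => l; rewrite row0.
  set k := row l _; have kB : k *m B = 0 by rewrite /k -row_mul mulmx_ker row0.
  (* k extended by zero outside S *)
  pose c := k *m rowsub (fun k : 'I_#|S| => enum_val k) (1%:M : 'M[R]_n).
  have cv m : c 0 (enum_val m) = k 0 m.
    rewrite !mxE (bigD1 m) //= big1 => [|m' m'm];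
      rewrite !mxE ?eqxx ?mulr1 ?addr0 //.
    by rewrite (inj_eq enum_val_inj) (negPf m'm) mulr0.
  suff c0 : c = 0 by apply/rowP=> m; rewrite -cv c0 !mxE.
  apply: indep => [i iS|];
    last by rewrite /c -mulmxA (mul_rowsub_mx _ 1%:M F) mul1mx.
  rewrite mxE big1 // => m _; rewrite !mxE.
  by case: eqP => [e|_]; rewrite ?mulr0 //; rewrite -e enum_valP in iS.
have /row_fullP[D DB] : row_full B by rewrite /row_full (eqP freeB) Sd.
by rewrite -(mul1mx z) -DB -mulmxA Bz mulmx0.
Qed.

Lemma general_position_spanning F (z : 'cV[R]_d) (T : {set 'I_n}) :
  rows_in_general_position setT F -> (d <= #|T|)%N ->
  (forall i, i \in T -> (F *m z) i 0 = 0) -> z = 0.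
Proof.
move=> gp dT Fz.
have [|||S [_ /subsetP ST Sd]] := @exists_intermediate_set _ set0 T d;
  rewrite ?sub0set ?cards0 //.
apply: (@rows_spanning S F z Sd); last by move=> i /ST; apply: Fz.
by apply: gp; rewrite ?Sd // subsetT.
Qed.

(** If f i combines the rows of A to a vector with nonzero i-th entry, then the
    combination with coefficients the sum of the t^i f i has entries that are
    nonzero polynomials in t, and these have a common non-root. *)
Lemma exists_nowhere_zero m (A : 'M[R]_(m, n)) :
  (forall i, exists c : 'rV[R]_m, (c *m A) 0 i != 0) ->
  exists c : 'rV[R]_m, forall i, (c *m A) 0 i != 0.
Proof.
move=> /fin_all_exists[f fP].
pose P j : {poly R} :=
  \poly_(i < n) (if insub i is Some i' then (f i' *m A) 0 j else 0).
have P0 : \prod_j P j != 0.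
  apply/prodf_neq0 => j _.
  apply: contraNneq (fP j) => /(congr1 (fun p : {poly R} => p`_j)).
  by rewrite coef0 coef_poly ltn_ord valK => ->.
have [t] := exists_nonroot P0.
rewrite -[_.[t]]/(horner_eval t _) rmorph_prod => /prodf_neq0 Pt.
exists (\sum_(i < n) t ^+ i *: f i) => j; have := Pt j isT.
rewrite /P /= /horner_eval horner_poly mulmx_suml summxE; congr (_ != 0).
by apply: eq_bigr => i _; rewrite valK /= -scalemxAl [RHS]mxE mulrC.
Qed.

(** A linear dependency among all rows, with nowhere vanishing coefficients, can
    be absorbed by scaling the rows.  Such a dependency exists because none of
    the coordinate functions vanishes on all dependencies: it would lie in the
    column space of F and vanish at the other nodes, which span. *)
Lemma exists_centered_rep (G : sgraph n) F : (d < n)%N ->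
  orthogonal_rep G setT F -> rows_in_general_position setT F ->
  exists F' : 'M[R]_(n, d),
    [/\ orthogonal_rep G setT F', rows_in_general_position setT F' &
      const_mx 1 *m F' = 0 :> 'rV_d].
Proof.
move=> dn rF gF.
have [i|c cP] := @exists_nowhere_zero _ (kermx F).
  suff /matrix0Pn[k [l]] : kermx F *m delta_mx i 0 != 0 :> 'cV_n.
    by rewrite -colE mxE => ki; exists (delta_mx 0 k); rewrite -rowE mxE.
  apply/eqP=> /in_column_space[z zE].
  have z0 : z = 0.
    apply: (general_position_spanning gF (T := ~: [set i])) => [|j].
      by rewrite cardsC1 card_ord; lia.
    by rewrite -zE !inE mxE => /negPf ->.
  move: zE; rewrite z0 mulmx0 => /matrixP/(_ i 0); rewrite !mxE !eqxx.
  by move/eqP; rewrite oner_eq0.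
have eF : (c *m kermx F) *m F = 0 by rewrite -mulmxA mulmx_ker mulmx0.
move: (c *m kermx F) cP eF => e e0 eF.
have rowE i : row i (diag_mx e *m F) = e 0 i *: row i F.
  by apply/rowP=> j; rewrite mul_diag_mx !mxE.
exists (diag_mx e *m F); split.
- move=> i j iT jT ij Gij; rewrite !rowE linearZ -scalemxAl -scalemxAr rF //.
  by rewrite !scaler0.
- move=> S ST Sd; apply/gram_detP => v vS; rewrite mulmxA => vF.
  have /gram_detP indep := gF S ST Sd.
  have v0 : v *m diag_mx e = 0.
    by apply: indep => // i iS; rewrite mul_mx_diag mxE vS // mul0r.
  apply/rowP=> i; have /rowP/(_ i)/eqP := v0.
  by rewrite mul_mx_diag !mxE mulf_eq0 (negPf (e0 i)) orbF => /eqP.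
rewrite mulmxA -[RHS]eF; congr (_ *m _).
by apply/rowP=> i; rewrite mul_mx_diag !mxE mul1r.
Qed.

(** The coordinates of the configuration form a basis of the left kernel of F
    augmented by a column of ones.  That matrix has rank d + 1, because the
    column of ones is nonzero and orthogonal to the columns of F. *)
Lemma exists_gale_dual r F : n = (d + r.+1)%N ->
  rows_in_general_position setT F -> const_mx 1 *m F = 0 :> 'rV_d ->
  exists P : 'M[R]_(n, r),
    [/\ P^T *m F = 0, const_mx 1 *m P = 0 :> 'rV_r, row_free P^T &
      forall v : 'rV[R]_n, v *m P = 0 -> exists z s, v = z *m F^T + const_mx s].
Proof.
move=> nE gF oF.
pose one : 'cV[R]_n := const_mx 1; pose A := row_mx F one.
have onene : const_mx 1 *m one = (n%:R)%:M :> 'M_1.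
  apply/matrixP=> i j; rewrite !ord1 !mxE eqxx mulr1n.
  rewrite (eq_bigr (fun=> 1)) => [|k _].
    by rewrite sumr_const card_ord.
  by rewrite !mxE mulr1.
have n0 : n%:R != 0 :> R by rewrite pnatr_eq0; lia.
have freeA : row_free A^T.
  rewrite -kermx_eq0; apply/eqP/row_matrixP => l; rewrite row0.
  set u := row l _; have : u *m A^T = 0 by rewrite /u -row_mul mulmx_ker row0.
  move=> /(congr1 trmx); rewrite trmx_mul trmxK trmx0.
  rewrite -(vsubmxK u^T) mul_row_col.
  set z := usubmx _; set s := dsubmx _ => Az.
  have s0 : s = 0.
    have /(congr1 (mulmx (const_mx 1 : 'rV_n))) := Az.
    rewrite mulmxDr !mulmxA oF mul0mx add0r onene mulmx0 mul_scalar_mx => /eqP.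
    by rewrite scaler_eq0 (negPf n0) => /eqP.
  move: Az; rewrite s0 mulmx0 addr0 => Fz.
  have z0 : z = 0.
    apply: (general_position_spanning gF (T := setT)) => [|j _].
      by rewrite cardsT card_ord; lia.
    by rewrite Fz mxE.
  by apply: trmx_inj; rewrite -(vsubmxK u^T) -/z -/s z0 s0 col_mx0 trmx0.
have rK : \rank (kermx A) = r.
  by rewrite mxrank_ker -mxrank_tr (eqP freeA) nE; lia.
have [B [BF KB BK]] : exists B : 'M[R]_(r, n),
    [/\ row_free B, (kermx A <= B)%MS & (B <= kermx A)%MS].
  rewrite -rK; exists (row_base (kermx A)).
  by split; rewrite ?row_base_free ?eq_row_base ?submx_refl.
exists B^T; rewrite trmxK.
have : B *m A = 0 by apply/sub_kermxP.
rewrite mul_mx_row -row_mx0 => /eq_row_mx[BF0 B1].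
split=> //.
  by apply: trmx_inj; rewrite trmx_mul trmxK trmx_const trmx0.
move=> v vB; have /in_column_space[z zE] : kermx A *m v^T = 0.
  have /submxP[D ->] := KB; rewrite -mulmxA; apply: trmx_inj.
  by rewrite trmx_mul trmx_mul trmxK vB mul0mx trmx0.
exists (usubmx z)^T, (dsubmx z 0 0).
apply: trmx_inj; rewrite zE -{1}(vsubmxK z) mul_row_col [RHS]linearD /=.
rewrite trmx_mul !trmxK; congr (_ + _).
by apply/colP=> i; rewrite !mxE big_ord1 !mxE mul1r.
Qed.

(** * Universal rigidity *)

Definition sqdist m (P : 'M[R]_(n, m)) i j : R :=
  (P *m P^T) i i + (P *m P^T) j j - 2 * (P *m P^T) i j.

(** The rows of the stress matrix F F^T sum to zero, so the squared norms drop
    out of the sum and only the scalar products remain. *)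
Lemma stress_energy m F (P : 'M[R]_(n, m)) : const_mx 1 *m F = 0 :> 'rV_d ->
  \sum_i \sum_j (F *m F^T) i j * sqdist P i j =
  - 2 * \tr ((P^T *m F) *m (P^T *m F)^T).
Proof.
move=> oF; set O := F *m F^T; set g := P *m P^T.
have Osym i j : O i j = O j i.
  by rewrite -[in LHS](trmxK O) mxE /O trmx_mul trmxK.
have O1 i : \sum_j O j i = 0.
  have /rowP/(_ i) : const_mx 1 *m O = 0 :> 'rV_n by rewrite mulmxA oF mul0mx.
  rewrite !mxE => H; rewrite -[RHS]H.
  by apply: eq_bigr => j _; rewrite !mxE mul1r.
rewrite trmx_mul trmxK mxtrace_mulC mulmxA -(mulmxA _ P) -/g -(mulmxA F^T).
have -> : \tr (F^T *m (g *m F)) = \sum_i \sum_j O i j * g i j.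
  rewrite mxtrace_mulC -mulmxA -/O mxtrace_mulC /mxtrace; apply: eq_bigr => i _.
  rewrite mxE; apply: eq_bigr => j _; congr (_ * _).
  by rewrite -[in LHS](trmxK g) mxE /g trmx_mul trmxK.
have gO0 : \sum_i \sum_j g i i * O j i = 0.
  by apply: big1 => i _; rewrite -mulr_sumr O1 mulr0.
transitivity (\sum_i \sum_j g i i * O j i + \sum_i \sum_j g j j * O i j
   - 2 * \sum_i \sum_j O i j * g i j); last first.
  by rewrite [X in _ + X - _]exchange_big /= !gO0 !add0r mulNr.
rewrite mulr_sumr -big_split -sumrB /=; apply: eq_bigr => i _.
rewrite !mulr_sumr -big_split -sumrB; apply: eq_bigr => j _ /=.
by rewrite /sqdist -/g (Osym j i); ring.
Qed.

(** The matrix D of changes of squared distances satisfies D F = 1 w, as both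
    frameworks are annihilated by F; w is orthogonal to all rows of F since D
    and F F^T have disjoint supports, so w = 0 and the rows of D are dependencies
    among few rows of F. *)
Lemma stressed_framework_universally_rigid (G : sgraph n) m m' F
    (P : 'M[R]_(n, m)) (P' : 'M[R]_(n, m')) :
  (d <= n)%N -> (forall b, (#|non_neighbours G b| <= d)%N) ->
  orthogonal_rep G setT F -> rows_in_general_position setT F ->
  const_mx 1 *m F = 0 :> 'rV_d -> P^T *m F = 0 ->
  (forall i j, G i j -> sqdist P' i j = sqdist P i j) ->
  forall i j, sqdist P' i j = sqdist P i j.
Proof.
move=> dn Nd rF gF oF PF eqG.
have sqdist_ii k (P1 : 'M[R]_(n, k)) i : sqdist P1 i i = 0.
  by rewrite /sqdist; ring.
have O0 i j : i != j -> ~~ G i j -> (F *m F^T) i j = 0.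
  move=> ij Gij; have := rF i j (in_setT _) (in_setT _) ij Gij.
  move=> /matrixP/(_ 0 0); rewrite !mxE => H; rewrite -[RHS]H.
  by apply: eq_bigr => k _; rewrite !mxE.
have P'F : P'^T *m F = 0.
  apply: gram_eq0; apply: (@mulfI _ (- 2)); first by rewrite oppr_eq0 pnatr_eq0.
  rewrite -stress_energy // mulr0.
  transitivity (- 2 * \tr ((P^T *m F) *m (P^T *m F)^T)).
    rewrite -stress_energy //; apply: eq_bigr => i _; apply: eq_bigr => j _.
    have [->|ij] := eqVneq i j; first by rewrite !sqdist_ii.
    by case: (boolP (G i j)) => [/eqG ->|/(O0 _ _ ij) ->]; rewrite ?mul0r.
  by rewrite PF mul0mx mxtrace0 mulr0.
pose D : 'M[R]_n := \matrix_(i, j) (sqdist P' i j - sqdist P i j).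
pose g := P *m P^T; pose g' := P' *m P'^T.
pose w : 'rV[R]_d := \sum_j (g' j j - g j j) *: row j F.
have gF0 : g *m F = 0 by rewrite /g -mulmxA PF mulmx0.
have g'F0 : g' *m F = 0 by rewrite /g' -mulmxA P'F mulmx0.
have sumF k : \sum_j F j k = 0.
  have /rowP/(_ k) := oF; rewrite !mxE => H; rewrite -[RHS]H.
  by apply: eq_bigr => j _; rewrite mxE mul1r.
have rowD i : row i D *m F = w.
  apply/rowP=> k; rewrite mxE summxE.
  have E1 : \sum_j g i j * F j k = 0.
    by have /matrixP/(_ i k) := gF0; rewrite !mxE.
  have E2 : \sum_j g' i j * F j k = 0.
    by have /matrixP/(_ i k) := g'F0; rewrite !mxE.
  transitivity (\sum_j ((g' j j - g j j) *: row j F) 0 k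
    + (g' i i - g i i) * (\sum_j F j k)
    - 2 * (\sum_j g' i j * F j k) + 2 * (\sum_j g i j * F j k)).
    rewrite !mulr_sumr -big_split -sumrB -big_split; apply: eq_bigr => j _ /=.
    by rewrite !mxE /sqdist -/g -/g' !mxE; ring.
  by rewrite E1 E2 sumF !mulr0 subr0 !addr0.
have D0 i j : i = j \/ G i j -> D i j = 0.
  by rewrite mxE => -[->|/eqG ->]; rewrite ?sqdist_ii subrr.
have w0 : w^T = 0.
  apply: (general_position_spanning gF (T := setT)) => [|i _].
    by rewrite cardsT card_ord.
  rewrite -(rowD i) trmx_mul mulmxA mxE big1 // => j _.
  have -> : (row i D)^T j 0 = D i j by rewrite [LHS]mxE [LHS]mxE.
  have [->|ij] := eqVneq i j; first by rewrite D0 ?mulr0; [|left].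
  case: (boolP (G i j)) => Gij; first by rewrite D0 ?mulr0; [|right].
  by rewrite O0 ?mul0r.
have Drow i : row i D = 0.
  have /gram_detP indep := gF (non_neighbours G i) (subsetT _) (Nd i).
  apply: indep => [j|]; last by rewrite rowD; apply: trmx_inj; rewrite w0 trmx0.
  rewrite !inE negb_and !negbK mxE => H; apply: D0.
  by case/orP: H => [/eqP ->|]; [left | right].
move=> i j; have /rowP/(_ j) := Drow i; rewrite !mxE => /eqP.
by rewrite subr_eq0 => /eqP.
Qed.
End Geometry.

Lemma enorm_sub_sqr (R : realType) n r (p : configuration R n r) i j :
  enorm (p i - p j) ^+ 2 = sqdist (\matrix_k p k) i j.
Proof.
rewrite sqr_sqrtr ?sumr_ge0 // => [|k _]; last exact: sqr_ge0.
rewrite /sqdist !mxE mulr_sumr -big_split -sumrB; apply: eq_bigr => k _ /=.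
by rewrite !mxE; ring.
Qed.

Theorem theorem1p1 (R : realType) (n r : nat) (hr : (1 <= r <= n - 2)%N)
    (G : sgraph n) (hG : vertex_connected G r.+1) :
  exists p : configuration R n r,
    [/\ affinely_spanning p, general_position p & universally_rigid G p].
Proof.
pose d := (n - r.+1)%N.
have nE : n = (d + r.+1)%N by lia.
have d0 : (0 < d)%N by lia.
have Nd b : (#|non_neighbours G b| <= d)%N.
  exact: few_non_neighbours nE d0 hG.
have [F0 [rF0 gF0]] : exists F : 'M[R]_(n, d),
    orthogonal_rep G setT F /\ rows_in_general_position setT F.
  apply: exists_general_position_rep => //.
  exact: vertex_connected_large_sets nE d0 hG.
have [|F [rF gF oF]] := exists_centered_rep _ rF0 gF0; first by lia.
have [P [PF oP freeP kerP]] := exists_gale_dual nE gF oF.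
have sumP (c : 'I_n -> R) : \sum_i c i *: row i P = (\row_i c i) *m P.
  by rewrite mulmx_sum_row; apply: eq_bigr => i _; rewrite mxE.
pose p : configuration R n r := fun i => row i P.
have PE : \matrix_k p k = P by apply/row_matrixP=> i; rewrite rowK.
exists p; split.
- (* The right inverse B gives the point x; as the columns of P sum to zero,
     adding a constant s to the coefficients adjusts their sum freely. *)
  move=> x; have /row_freeP[B PB] := freeP.
  pose c0 := x *m B^T; pose s := (1 - \sum_i c0 0 i) / n%:R.
  have c0P : c0 *m P = x.
    by rewrite /c0 -mulmxA -{1}(trmxK P) -trmx_mul PB trmx1 mulmx1.
  exists (fun i => c0 0 i + s); split.
    rewrite big_split /= sumr_const card_ord -mulr_natr divfK.
      by rewrite addrC subrK.
    by rewrite pnatr_eq0; lia.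
  rewrite sumP (_ : \row_i _ = c0 + s *: const_mx 1).
    by rewrite mulmxDl c0P -scalemxAl oP scaler0 addr0.
  by apply/rowP=> i; rewrite !mxE mulr1.
- move=> S Sr c; rewrite big_mkcond => c1 cP.
  pose v : 'rV[R]_n := \row_i (if i \in S then c i else 0).
  have [z [s vE]] : exists z s, v = z *m F^T + const_mx s.
    apply: kerP; rewrite /v -sumP; apply: etrans cP.
    rewrite [RHS]big_mkcond; apply: eq_bigr => i _.
    by case: ifP; rewrite ?scale0r.
  have s0 : s = 0.
    have : v *m const_mx 1 = 0 :> 'M_1.
      apply/matrixP=> i j; rewrite !mxE -[RHS]c1; apply: eq_bigr => k _.
      by rewrite !mxE mulr1.
    rewrite vE mulmxDl -mulmxA -[F^T *m _]trmxK trmx_mul trmxK trmx_const oF.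
    rewrite trmx0 mulmx0 add0r => /matrixP/(_ 0 0).
    rewrite !mxE (eq_bigr (fun=> s)) => [|k _]; last by rewrite !mxE mulr1.
    rewrite sumr_const card_ord -mulr_natr => /eqP; rewrite mulf_eq0 pnatr_eq0.
    by case/orP=> [/eqP //|]; lia.
  have vF i : v 0 i = (F *m z^T) i 0.
    by rewrite vE s0 -[F *m _]trmxK trmx_mul trmxK !mxE addr0.
  have z0 : z^T = 0.
    apply: (general_position_spanning gF (T := ~: S)) => [|i].
      by rewrite cardsCs setCK card_ord Sr; lia.
    by rewrite -vF !inE mxE => /negPf ->.
  by move=> i iS; have := vF i; rewrite z0 mulmx0 !mxE iS.
case=> r' [p' [_ _ eqp ncong]]; apply: ncong => i j.
rewrite !enorm_sub_sqr PE.
apply: (stressed_framework_universally_rigid (F := F) _ Nd) => //.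
  by lia.
move=> k l Gkl; have := eqp k l Gkl.
by rewrite !enorm_sub_sqr PE.
Qed.
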